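(* Let $\Psi \colon \mathbb{C}^n \to \mathbb{C}^n$ be a complex-linear map. The following are equivalent: (1) $\Psi$ preserves the linear special Lagrangian width of every ellipsoid centered at the origin, that is, $w(\Psi(E)) = w(E)$ for every such ellipsoid $E\subset\mathbb{R}^{2n}$. (2) $\Psi$ preserves $\Omega$ up to a phase, that is, $\Psi^*\Omega = e^{i\theta}\Omega$ for some real $\theta$.
   Context: Identify $\mathbb{C}^n = \mathbb{R}^{2n}$ with coordinates $z^k = x^k+iy^k$ and the standard Euclidean metric. $\Omega = dz^1\wedge\cdots\wedge dz^n$ is regarded as a complex-valued $n$-form on $\mathbb{R}^{2n}$. $B(r)$ is the closed ball of radius $r$ centered at the origin in $\mathbb{R}^{2n}$. An affine map $z\mapsto Az+b$ of $\mathbb{R}^{2n}$ ($A$ real-linear) preserves $\Omega$ if $A^*\Omega=\Omega$. The linear special Lagrangian width of a subset $S\subseteq\mathbb{R}^{2n}$ is $w(S) = \sup\{\mathcal{V}_n r^n : \Phi(B(r))\subseteq S \text{ for some affine map } \Phi \text{ preserving } \Omega\}\in[0,\infty]$, where $\mathcal{V}_n$ is the volume of the unit ball in $\mathbb{R}^n$; the supremum is over $r>0$ and is $0$ if no such $r$ exists. Ellipsoids centered at the origin are closed solid ellipsoids in $\mathbb{R}^{2n}$, i.e. sets $\{z : \langle z, Mz\rangle\leq 1\}$ with $M$ a real symmetric positive-definite $2n\times 2n$ matrix. *)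

(* Defs.v *)
From HB Require Import structures.
From mathcomp Require Import all_boot all_order all_algebra.
From mathcomp Require Import all_classical all_reals all_analysis.
From mathcomp Require Import complex.

Set Implicit Arguments.
Unset Strict Implicit.
Unset Printing Implicit Defensive.

Import Order.TTheory GRing.Theory Num.Theory.

Local Open Scope classical_set_scope.
Local Open Scope complex_scope.
Local Open Scope ring_scope.

Section Euclidean.
Variable R : realType.

Definition dot m (u v : 'cV[R]_m) : R := \sum_(i < m) u i 0 * v i 0.

(* The library's norm on matrices is the sup norm, hence this one. *)
Definition enorm m (v : 'cV[R]_m) : R := Num.sqrt (dot v v).

Definition eball m (r : R) : set 'cV[R]_m := [set v | enorm v <= r].

Definition ellipsoid m (M : 'M[R]_m) : set 'cV[R]_m :=
  [set z | dot z (M *m z) <= 1].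

Definition sym_posdef m (M : 'M[R]_m) : Prop :=
  M^T = M /\ forall z : 'cV[R]_m, z != 0 -> 0 < dot z (M *m z).

(* Lebesgue measure on R^m: the m-fold product of the library's measure on R,
   transported along R * R^m ~ R^(m+1); on R^0 it is the unit point mass. *)
Fixpoint lebesgue_tuple m : set (m.-tuple (measurableTypeR R)) -> \bar R :=
  match m with
  | 0 => fun A => dirac [tuple] A
  | k.+1 => pushforward (lebesgue_measure \x lebesgue_tuple (m := k))%E
              (fun p : measurableTypeR R * k.-tuple (measurableTypeR R) =>
                 [tuple of p.1 :: p.2])
  end.

Definition unit_ball_volume m : \bar R :=
  lebesgue_tuple [set t : m.-tuple (measurableTypeR R) |
    eball 1 (\col_i (tnth t i : R))].

End Euclidean.

Section Width.
Variables (R : realType) (n : nat).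

(* C^n is R^(n + n), with the x^k listed before the y^k. *)
Definition dz (k : 'I_n) (z : 'cV[R]_(n + n)) : R[i] :=
  z (lshift n k) 0 +i* z (rshift n k) 0.

Definition to_complex (z : 'cV[R]_(n + n)) : 'cV[R[i]]_n := \col_k dz k z.

Definition of_complex (c : 'cV[R[i]]_n) : 'cV[R]_(n + n) :=
  col_mx (\col_k complex.Re (c k 0)) (\col_k complex.Im (c k 0)).

Definition realify (f : 'cV[R[i]]_n -> 'cV[R[i]]_n) :
    'cV[R]_(n + n) -> 'cV[R]_(n + n) :=
  fun z => of_complex (f (to_complex z)).

(* Constant-coefficient complex-valued n-forms, as functions of n vectors. *)
Definition nform := ('I_n -> 'cV[R]_(n + n)) -> R[i].

(* dz^1 /\ ... /\ dz^n, with the convention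
   (a^1 /\ ... /\ a^n)(v_1, ..., v_n) = det (a^j(v_k)). *)
Definition Omega : nform := fun v => \det (\matrix_(j, k) dz j (v k)).

Definition pullback (f : 'cV[R]_(n + n) -> 'cV[R]_(n + n)) (w : nform) :
    nform :=
  fun v => w (fun k => f (v k)).

Definition preserves_Omega (A : 'M[R]_(n + n)) : Prop :=
  forall v, pullback (mulmx A) Omega v = Omega v.

(* The point 0 makes the supremum 0 when no ball embeds. *)
Definition slwidth (S : set 'cV[R]_(n + n)) : \bar R :=
  ereal_sup ([set 0%E] `|`
    [set x | exists r : R, [/\ 0 < r,
       exists (A : 'M[R]_(n + n)) (b : 'cV[R]_(n + n)),
         preserves_Omega A /\
         (fun z => A *m z + b) @` eball r `<=` S
     & x = (unit_ball_volume R n * (r ^+ n)%:E)%E]]).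

End Width.

Definition expi (R : realType) (theta : R) : R[i] := cos theta +i* sin theta.

(* Main.v *)
Require Import Defs.
From HB Require Import structures.
From mathcomp Require Import all_boot all_order all_algebra.
From mathcomp Require Import perm.
From mathcomp Require Import all_classical all_reals all_analysis.
From mathcomp Require Import complex.

(** In complex coordinates [Psi] is a matrix [P], and its pullback multiplies
    [Omega] by [\det P]; so the second condition says [|\det P| = 1].

    The width is homogeneous: if [P] is invertible, then
    [w(P S) = |\det P| * w(S)] for every set [S] ([slwidth_realmx]).  Indeed,
    let [u] be an n-th root of [\det P].  If [z |-> A z + b] preserves [Omega]
    and maps the ball of radius [r] into [S], then [z |-> P A (z / u) + P b]
    preserves [Omega], because the scalar [1 / u] has complex determinant
    [1 / \det P], and it maps the ball of radius [|u| r] into [P S].  Since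
    [|u| ^ n = |\det P|], this gives one inequality; the other one is the same
    statement for the inverse of [P].  Hence [|\det P| = 1] implies that widths
    are preserved.

    For the converse it is enough to test the unit ball, which is an ellipsoid.
    Suppose that an affine map with linear part [A], preserving [Omega], sends
    the ball of radius [r] into the image under [P] of the unit ball.  Then the
    vectors [r A e_k] are images under [P] of differences of two points of the
    unit ball, and evaluating [Omega] on them bounds [r ^ n] by
    [|\det P| * n! * 2 ^ n] ([slwidth_ball_le]).  For [P = 1] this says that the
    unit ball has finite width; for [\det P = 0] it says that its image has
    width 0, whereas the unit ball has positive width.  So a [P] that preserves
    the width of the unit ball is invertible, and homogeneity then forces
    [|\det P| = 1].  This uses that the volume of the unit ball of [R^n] is
    positive and finite, which follows by comparison with cubes. *)

Set Implicit Arguments.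
Unset Strict Implicit.
Unset Printing Implicit Defensive.

Import Order.TTheory GRing.Theory Num.Theory.
Local Open Scope classical_set_scope.
Local Open Scope complex_scope.
Local Open Scope ring_scope.

(** * Volume of the unit ball *)

Section Volume.
Variable R : realType.
Local Open Scope ereal_scope.

(** The integral of a nonnegative function is a supremum over the simple
    functions below it, so monotonicity holds without measurability; this lets
    [lebesgue_tuple] be compared on sets that are not known to be measurable. *)
Lemma ge0_le_integral_nonmeas d (T : measurableType d)
    (mu : {measure set T -> \bar R}) (f g : T -> \bar R) :
  (forall x, 0 <= f x) -> (forall x, f x <= g x) ->
  \int[mu]_x f x <= \int[mu]_x g x.
Proof.
move=> f0 fg; rewrite !ge0_integralTE //; last first.
  by move=> x; exact: le_trans (fg x).
apply: ereal_sup_le => _ [h /= hf <-]; exists h => //= x.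
exact: le_trans (fg x).
Qed.

Lemma lebesgue_tuple_ge0 m (A : set (m.-tuple (measurableTypeR R))) :
  0 <= lebesgue_tuple A.
Proof.
elim: m A => [|m IH] A /=; first exact: measure_ge0.
by apply: integral_ge0 => x _; exact: IH.
Qed.

Lemma lebesgue_tuple_le m (A B : set (m.-tuple (measurableTypeR R))) :
  A `<=` B -> lebesgue_tuple A <= lebesgue_tuple B.
Proof.
elim: m A B => [|m IH] A B AB /=.
  rewrite !diracE lee_fin ler_nat.
  by case: (boolP (_ \in A)) => // /set_mem /AB /mem_set ->.
apply: ge0_le_integral_nonmeas => x; first exact: lebesgue_tuple_ge0.
by apply: IH => y; rewrite /xsection /= !inE; exact: AB.
Qed.

Lemma lebesgue_tuple0 m :
  lebesgue_tuple (set0 : set (m.-tuple (measurableTypeR R))) = 0.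
Proof.
elim: m => [|m IH] /=; first exact: measure0.
rewrite /pushforward /product_measure1 preimage_set0.
by apply: integral0_eq => x _ /=; rewrite xsection0.
Qed.

Definition cube m (c : R) : set (m.-tuple (measurableTypeR R)) :=
  [set t | forall i, (`|tnth t i : R| <= c)%R].
Arguments cube : clear implicits.

Lemma lebesgue_tuple_cube m (c : R) : (0 < c)%R ->
  lebesgue_tuple (cube m c) = ((c *+ 2) ^+ m)%:E.
Proof.
move=> c0; elim: m => [|m IH] /=.
  by rewrite diracE mem_set // => -[].
rewrite /pushforward /product_measure1.
have -> : lebesgue_tuple (m:=m) \o
    xsection ((fun p : measurableTypeR R * m.-tuple (measurableTypeR R) =>
      [tuple of p.1 :: p.2]) @^-1` cube m.+1 c) =
    (cst (((c *+ 2) ^+ m)%:E) \_ [set` `[(- c)%R, c]]).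
  apply/funext => x; rewrite patchE /=.
  rewrite mem_setE in_itv /= -ler_norml.
  case: ifPn => xc.
    rewrite -IH; congr lebesgue_tuple; apply/seteqP; split => t.
      rewrite /xsection /= inE /= => h i.
      by have := h (lift ord0 i); rewrite tnthS.
    rewrite /xsection /= inE /= => h i.
    by case: (unliftP ord0 i) => [j|] ->; rewrite ?tnthS ?tnth0.
  transitivity (lebesgue_tuple (set0 : set (m.-tuple (measurableTypeR R))));
    last exact: lebesgue_tuple0.
  congr lebesgue_tuple.
  apply/seteqP; split => t //; rewrite /xsection /= inE /= => /(_ ord0).
  by rewrite tnth0 (negbTE xc).
rewrite -integral_mkcond integral_cst; last exact: measurable_itv.
apply: etrans (congr1 _ (lebesgue_measure_itv _)) _.
rewrite /= lte_fin ifT; last by rewrite gtrN.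
by rewrite -EFinB -EFinM opprK -mulr2n exprSr.
Qed.

(** The cube of half-side [1 / (m + 1)] lies in the unit ball, as
    [m / (m + 1) ^ 2 <= 1]. *)
Lemma unit_ball_volume_gt0 m : 0 < unit_ball_volume R m.
Proof.
have c0 : (0 < m.+1%:R^-1 :> R)%R by rewrite invr_gt0 ltr0Sn.
apply: (@lt_le_trans _ _ (lebesgue_tuple (cube m (m.+1%:R^-1)%R))).
  by rewrite lebesgue_tuple_cube // lte_fin exprn_gt0 // mulrn_wgt0.
apply: lebesgue_tuple_le => t ht; rewrite /eball /enorm /=.
rewrite -sqrtr1 ler_wsqrtr //.
apply: (@le_trans _ _ (\sum_(i < m) m.+1%:R^-1)%R).
  apply: ler_sum => i _; rewrite !mxE -expr2 -real_normK ?num_real //.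
  apply: (@le_trans _ _ (m.+1%:R^-1 ^+ 2)%R).
    by rewrite lerXn2r // ?nnegrE ?normr_ge0 ?ltW.
  rewrite expr2; apply: ler_piMl; first exact: ltW.
  by rewrite invf_le1 ?ltr0Sn // ler1n.
by rewrite sumr_const card_ord -[leLHS]mulr_natl ler_pdivrMr ?ltr0Sn //
  mul1r ler_nat.
Qed.

(** The unit ball lies in the cube of half-side 1. *)
Lemma unit_ball_volume_lty m : unit_ball_volume R m < +oo.
Proof.
apply: (@le_lt_trans _ _ (lebesgue_tuple (cube m 1%R))); last first.
  by rewrite lebesgue_tuple_cube // ltry.
apply: lebesgue_tuple_le => t; rewrite /eball /enorm /= => ht i.
rewrite -sqrtr_sqr; apply: le_trans ht; rewrite ler_wsqrtr //.
rewrite /dot (bigD1 i) //= !mxE -expr2 lerDl.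
by apply: sumr_ge0 => j _; rewrite -expr2 sqr_ge0.
Qed.

End Volume.

(** * Complex matrices acting on real coordinates *)

Section RealForm.
Variables (R : realType) (n : nat).
Local Notation normc := (@Normc.normc R).
Implicit Types (P Q : 'M[R[i]]_n) (z : 'cV[R]_(n + n)) (c : 'cV[R[i]]_n).

Lemma normE (x : R[i]) : `|x| = (normc x)%:C.
Proof. by case: x. Qed.

Lemma normc_ge0 (x : R[i]) : 0 <= normc x.
Proof. by case: x => a b; exact: sqrtr_ge0. Qed.

Lemma normcX (x : R[i]) k : normc (x ^+ k) = normc x ^+ k.
Proof.
elim: k => [|k IH]; first by rewrite !expr0 Normc.normc1.
by rewrite !exprS Normc.normcM IH.
Qed.

Lemma normc_gt0 (x : R[i]) : x != 0 -> 0 < normc x.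
Proof.
move=> x0; rewrite lt_neqAle normc_ge0 andbT eq_sym.
by apply: contra x0 => /eqP/Normc.eq0_normc ->.
Qed.

Lemma to_complexK : cancel (@to_complex R n) (@of_complex R n).
Proof.
move=> z; apply/colP => i; rewrite /of_complex.
by case: (split_ordP i) => j ->; rewrite ?col_mxEu ?col_mxEd !mxE.
Qed.

Lemma of_complexK : cancel (@of_complex R n) (@to_complex R n).
Proof.
move=> c; apply/colP => i; rewrite mxE /dz /of_complex.
by rewrite col_mxEu col_mxEd !mxE; case: (c i 0).
Qed.

Lemma dzB k z1 z2 : dz k (z1 - z2) = dz k z1 - dz k z2.
Proof. by rewrite /dz !mxE. Qed.

(** The real matrix, in the coordinates [(x, y)], of the complex-linear map with
    matrix [P]. *)
Definition realmx P : 'M[R]_(n + n) :=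
  block_mx (map_mx (@complex.Re R) P) (- map_mx (@complex.Im R) P)
           (map_mx (@complex.Im R) P) (map_mx (@complex.Re R) P).

Lemma Re_sum (I : finType) (F : I -> R[i]) :
  complex.Re (\sum_i F i) = \sum_i complex.Re (F i).
Proof. by apply: (big_morph (@complex.Re R)) => // -[? ?] [? ?]. Qed.

Lemma Im_sum (I : finType) (F : I -> R[i]) :
  complex.Im (\sum_i F i) = \sum_i complex.Im (F i).
Proof. by apply: (big_morph (@complex.Im R)) => // -[? ?] [? ?]. Qed.

Lemma to_complex_realmx P z :
  to_complex (realmx P *m z) = P *m to_complex z.
Proof.
rewrite -{1}[z]vsubmxK /realmx mul_block_col; apply/colP => i.
rewrite mxE /dz col_mxEu col_mxEd !mxE; apply/eqP; rewrite eq_complex.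
rewrite Re_sum Im_sum /=; apply/andP; split; apply/eqP;
    apply: etrans (esym (big_split _ _ _ _ _)) _ => /=.
  by apply: eq_bigr => j _; rewrite !mxE; case: (P i j) => a b /=; rewrite mulNr.
by apply: eq_bigr => j _; rewrite !mxE; case: (P i j) => a b /=; rewrite addrC.
Qed.

Lemma realmxE P z : realmx P *m z = of_complex (P *m to_complex z).
Proof. by rewrite -to_complex_realmx to_complexK. Qed.

Lemma realmx1 z : realmx 1%:M *m z = z.
Proof. by rewrite realmxE mul1mx to_complexK. Qed.

Lemma realmxK P : P \in unitmx ->
  cancel (mulmx (realmx P)) (mulmx (realmx (invmx P)) : 'cV_(n + n) -> _).
Proof.
by move=> uP z; rewrite [RHS]/= !realmxE of_complexK mulKmx // to_complexK.
Qed.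

(** The determinant here is the complex one: evaluating [Omega] on a frame is
    taking the determinant of its complex coordinates. *)
Lemma Omega_realmx P v :
  Omega (fun k => realmx P *m v k) = \det P * Omega v.
Proof.
rewrite -det_mulmx; congr (\det _); apply/matrixP => j k.
have /colP/(_ j) := to_complex_realmx P (v k).
by rewrite !mxE => ->; apply: eq_bigr => i _; rewrite !mxE.
Qed.

Lemma dot_complex z : dot z z = \sum_(k < n) normc (dz k z) ^+ 2.
Proof.
rewrite /dot big_split_ord /=.
apply: etrans (esym (big_split _ _ _ _ _)) _; apply: eq_bigr => k _.
by rewrite sqr_sqrtr ?addr_ge0 ?sqr_ge0 // !expr2.
Qed.

Lemma normc_dz_le k z : normc (dz k z) <= enorm z.
Proof.
rewrite -[leLHS]ger0_norm ?normc_ge0 // -sqrtr_sqr ler_wsqrtr //.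
rewrite dot_complex (bigD1 k) //= lerDl.
by apply: sumr_ge0 => j _; rewrite sqr_ge0.
Qed.

Lemma enorm_realmx_scalar (u : R[i]) z :
  enorm (realmx u%:M *m z) = normc u * enorm z.
Proof.
rewrite /enorm -[normc u]ger0_norm ?normc_ge0 // -sqrtr_sqr -sqrtrM ?sqr_ge0 //.
rewrite !dot_complex mulr_sumr; congr Num.sqrt; apply: eq_bigr => k _.
have /colP/(_ k) := to_complex_realmx u%:M z.
by rewrite mul_scalar_mx !mxE => ->; rewrite Normc.normcM exprMn.
Qed.

(** The complex standard basis, used as a frame on which [Omega] is 1. *)
Definition std_frame (k : 'I_n) : 'cV[R]_(n + n) := of_complex (delta_mx k 0).

Lemma Omega_std_frame : Omega std_frame = 1.
Proof.
rewrite -(det1 _ n); congr (\det _); apply/matrixP => j k.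
have /colP/(_ j) := of_complexK (delta_mx k 0).
by rewrite !mxE => ->; rewrite eqxx andbT.
Qed.

Lemma enorm_std_frame k : enorm (std_frame k) = 1.
Proof.
rewrite /enorm dot_complex -sqrtr1; congr Num.sqrt.
have E j : dz j (std_frame k) = (j == k)%:R.
  have /colP/(_ j) := of_complexK (delta_mx k 0).
  by rewrite !mxE => ->; rewrite eqxx andbT.
rewrite (bigD1 k) // E eqxx Normc.normc1 expr1n big1 => [|j /negbTE jk].
  exact: addr0.
by rewrite E jk Normc.normc0 expr0n.
Qed.

End RealForm.

(** A crude form of Hadamard's inequality: the Leibniz expansion has [n`!] terms,
    each a product of [n] entries. *)
Lemma norm_det_le (F : numDomainType) n (Z : 'M[F]_n) (K : F) :
  (forall i j, `|Z i j| <= K) -> `|\det Z| <= n`!%:R * K ^+ n.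
Proof.
move=> ZK; apply: le_trans (ler_norm_sum _ _ _) _.
apply: (@le_trans _ _ (\sum_(s : {perm 'I_n}) K ^+ n)); last first.
  by rewrite sumr_const card_Sn mulr_natl.
apply: ler_sum => s _; rewrite normrM normr_sign mul1r normr_prod.
have -> : K ^+ n = \prod_(i < n) K by rewrite prodr_const card_ord.
by apply: ler_prod => i _; rewrite normr_ge0 ZK.
Qed.

(** * Linear special Lagrangian width *)

Section SLWidth.
Variables (R : realType) (n : nat).
Local Notation normc := (@Normc.normc R).
Implicit Types (P : 'M[R[i]]_n) (S : set 'cV[R]_(n + n)) (r : R).

Lemma complex_root (x : R[i]) : x != 0 -> (0 < n)%N ->
  exists2 u : R[i], u != 0 & u ^+ n = x.
Proof.
move=> x0 n0; exists (n.-root x); last exact: rootCK.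
by rewrite rootC_eq0.
Qed.

Lemma slwidth_ge0 S : (0 <= slwidth S)%E.
Proof. by apply: ereal_sup_ubound; left. Qed.

(** Precomposing an embedding of a ball with division by an n-th root [u] of
    [\det P] cancels the factor by which [P] multiplies [Omega], and turns the
    radius [r] into [|u| r]. *)
Lemma slwidth_realmx_ge P S : P \in unitmx ->
  ((normc (\det P))%:E * slwidth S <= slwidth (mulmx (realmx P) @` S))%E.
Proof.
rewrite unitmxE unitfE => D0; have d0 := normc_gt0 D0.
(* In dimension 0 the determinant is 1 and any scalar serves as its root. *)
have [u u0 uD] : exists2 u : R[i], u != 0 & u ^+ n = \det P.
  have [n0|n0] := posnP n; last exact: complex_root.
  by move: P {D0 d0}; rewrite n0 => P; exists 1; rewrite ?oner_eq0 // det_mx00.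
have nu0 : 0 < normc u := normc_gt0 u0.
rewrite muleC -lee_pdivlMr //.
apply: ge_ereal_sup => _ [->|[r [r0 [A [b [AO AS]]] ->]]].
  by rewrite mule_ge0 ?slwidth_ge0 // lee_fin invr_ge0 ltW.
rewrite lee_pdivlMr //; apply: ereal_sup_ubound; right.
exists (normc u * r); split; first exact: mulr_gt0.
  exists (realmx P *m A *m realmx (u^-1)%:M), (realmx P *m b); split.
    move=> v; rewrite /pullback.
    have -> : (fun k => realmx P *m A *m realmx (u^-1)%:M *m v k) =
              (fun k => realmx P *m (A *m (realmx (u^-1)%:M *m v k))).
      by apply/funext => k; rewrite !mulmxA.
    rewrite Omega_realmx.
    have := AO (fun k => realmx (u^-1)%:M *m v k).
    rewrite /pullback => ->; rewrite Omega_realmx det_scalar mulrA.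
    by rewrite exprVn uD mulfV // mul1r.
  move=> _ [z zB <-]; exists (A *m (realmx (u^-1)%:M *m z) + b).
    apply: AS; exists (realmx (u^-1)%:M *m z) => //.
    rewrite /eball /= enorm_realmx_scalar Normc.normcV mulrC.
    by rewrite ler_pdivrMr // mulrC.
  by rewrite mulmxDr !mulmxA.
by rewrite exprMn -normcX uD EFinM -muleA -EFinM mulrC.
Qed.

(** The reverse inequality is [slwidth_realmx_ge] for the inverse matrix. *)
Lemma slwidth_realmx P S : P \in unitmx ->
  slwidth (mulmx (realmx P) @` S) = ((normc (\det P))%:E * slwidth S)%E.
Proof.
move=> uP; apply/eqP; rewrite eq_le slwidth_realmx_ge // andbT.
have d0 : 0 < normc (\det P) by apply: normc_gt0; rewrite -unitfE -unitmxE.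
have := @slwidth_realmx_ge (invmx P) (mulmx (realmx P) @` S).
rewrite unitmx_inv => /(_ uP); rewrite det_inv Normc.normcV.
rewrite lee_pdivrMl //; congr (_ <= _ * slwidth _)%E.
apply/seteqP; split => [_ [_ [z zS <-] <-]|z zS]; rewrite ?realmxK //.
by exists (realmx P *m z); [exists z | rewrite realmxK].
Qed.

(** The matrix [P] is arbitrary: invertible matrices give finiteness of the
    width, singular ones its vanishing.  The factor [2 ^ n] is there because the
    translation part of an embedding is eliminated by taking differences of two
    points of the unit ball, and these have norm at most 2. *)
Lemma slwidth_ball_le P :
  (slwidth (mulmx (realmx P) @` eball 1%R) <=
   unit_ball_volume R n * (normc (\det P) * (n`!%:R * 2 ^+ n))%:E)%E.
Proof.
have V0 : (0 <= unit_ball_volume R n)%E by exact: lebesgue_tuple_ge0.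
apply: ge_ereal_sup => _ [->|[r [r0 [A [b [AO AS]]] ->]]].
  by rewrite mule_ge0 // lee_fin !mulr_ge0 ?normc_ge0 ?exprn_ge0.
apply: lee_wpmul2l => //; rewrite lee_fin.
(* The centre [b] of the embedded ball is the image of [y0], and the tip of
   [r e_k] is the image of [y k]. *)
have AS' z : eball r z -> exists2 y : 'cV[R]_(n + n), eball 1 y &
    realmx P *m y = A *m z + b.
  by move=> zB; have [] := AS (A *m z + b) (imageP _ zB) => y; exists y.
have [y0 y0B y0E] : exists2 y : 'cV[R]_(n + n), eball 1 y & realmx P *m y = b.
  have [|y yB yE] := AS' 0; last by exists y; rewrite // yE mulmx0 add0r.
  rewrite /eball /= /enorm /dot big1 ?sqrtr0 ?ltW // => i _.
  by rewrite mxE mul0r.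
have normcr : normc r%:C = r by rewrite /= expr0n addr0 sqrtr_sqr gtr0_norm.
have eB (k : 'I_n) : eball r (realmx (r%:C)%:M *m std_frame R k).
  by rewrite /eball /= enorm_realmx_scalar enorm_std_frame mulr1 normcr.
have /choice [y yP] : forall k, exists y : 'cV[R]_(n + n),
    eball 1 y /\ realmx P *m y = A *m (realmx (r%:C)%:M *m std_frame R k) + b.
  by move=> k; have [y ? ?] := AS' _ (eB k); exists y.
(* Evaluate [Omega] on the vectors [r A e_k = P (y k - y0)]. *)
have detE : (r%:C) ^+ n = \det P * Omega (fun k => y k - y0).
  rewrite -Omega_realmx.
  have -> : (fun k => realmx P *m (y k - y0)) =
      (fun k => A *m (realmx (r%:C)%:M *m std_frame R k)).
    by apply/funext => k; rewrite mulmxBr (yP k).2 y0E addrK.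
  have := AO (fun k => realmx (r%:C)%:M *m std_frame R k).
  rewrite /pullback => ->.
  by rewrite Omega_realmx det_scalar Omega_std_frame mulr1.
have -> : r ^+ n = normc (\det P) * normc (Omega (fun k => y k - y0)).
  by rewrite -Normc.normcM -detE normcX normcr.
rewrite ler_wpM2l ?normc_ge0 // -lecR -normE.
have -> : (n`!%:R * 2 ^+ n)%:C = n`!%:R * 2 ^+ n :> R[i].
  by rewrite rmorphM rmorphXn /= !rmorph_nat.
apply: norm_det_le => j k; rewrite mxE dzB.
apply: le_trans (ler_normB _ _) _; rewrite !normE.
have dz1 (x : 'cV[R]_(n + n)) : eball 1 x -> (normc (dz j x))%:C <= 1.
  by move=> xB; rewrite (lecR _ 1); apply: le_trans (normc_dz_le j x) xB.
by rewrite (lerD (dz1 _ (yP k).1) (dz1 _ y0B)).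
Qed.

Lemma slwidth_ball_lty : (slwidth (eball (m:=n + n) (1 : R)) < +oo)%E.
Proof.
have -> : eball 1 = mulmx (realmx 1%:M) @` eball (1 : R) :> set 'cV[R]_(n + n).
  apply/seteqP; split => [z zB|_ [z zB <-]]; last by rewrite realmx1.
  by exists z => //; rewrite realmx1.
apply: le_lt_trans (slwidth_ball_le _) _.
have V0 : (0 <= unit_ball_volume R n)%E by exact: lebesgue_tuple_ge0.
have VF : unit_ball_volume R n \is a fin_num.
  by rewrite ge0_fin_numE // unit_ball_volume_lty.
by rewrite -(fineK VF) -EFinM ltry.
Qed.

(** The identity embeds the unit ball in itself. *)
Lemma slwidth_ball_gt0 : (0 < slwidth (eball (m:=n + n) (1 : R)))%E.
Proof.
apply: lt_le_trans (unit_ball_volume_gt0 R n) _.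
apply: ereal_sup_ubound; right; exists 1; split => //.
  exists 1%:M, 0; split.
    move=> v; congr Omega; apply/funext => k; exact: mul1mx.
  by move=> _ [z zB <-]; rewrite mul1mx addr0.
by rewrite expr1n mule1.
Qed.

Lemma ellipsoid1 : ellipsoid 1%:M = eball 1 :> set 'cV[R]_(n + n).
Proof.
apply/seteqP; split => z; rewrite /ellipsoid /eball /enorm /= mul1mx.
  by move=> h; rewrite -sqrtr1 ler_wsqrtr.
by rewrite -{1}sqrtr1 ler_sqrt.
Qed.

Lemma sym_posdef1 m : sym_posdef (1%:M : 'M[R]_m).
Proof.
split=> [|z z0]; first exact: trmx1.
rewrite mul1mx lt_neqAle; apply/andP; split; last first.
  by apply: sumr_ge0 => i _; rewrite -expr2 sqr_ge0.
apply: contra z0; rewrite eq_sym psumr_eq0 => [/allP h|i _]; last first.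
  by rewrite -expr2 sqr_ge0.
apply/eqP/colP => i; rewrite mxE; have := h i (mem_index_enum _).
by rewrite -expr2 sqrf_eq0 => /eqP.
Qed.

End SLWidth.

(** * Phases *)

(** The arccosine of the real part is an argument up to sign, and the sign is
    that of the imaginary part. *)
Lemma expi_surj (R : realType) (x : R[i]) :
  Normc.normc x = 1 -> exists theta, x = expi theta.
Proof.
case: x => a b /= ab1.
have ab : a ^+ 2 + b ^+ 2 = 1.
  by rewrite -[LHS]sqr_sqrtr ?addr_ge0 ?sqr_ge0 // ab1 expr1n.
have a1 : -1 <= a <= 1.
  rewrite -ler_norml -sqrtr_sqr -sqrtr1 ler_wsqrtr // -ab lerDl.
  by rewrite sqr_ge0.
have bE : Num.sqrt (1 - a ^+ 2) = `|b|.
  by rewrite -ab addrAC subrr add0r sqrtr_sqr.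
have [b0|b0] := leP 0 b.
  exists (acos a); rewrite /expi sin_acos // acosK ?in_itv //= bE.
  by rewrite ger0_norm.
exists (- acos a); rewrite /expi cosN sinN sin_acos // acosK ?in_itv //= bE.
by rewrite ltr0_norm // opprK.
Qed.

Lemma normc_expi (R : realType) (theta : R) : Normc.normc (expi theta) = 1.
Proof. by rewrite /= cos2Dsin2 sqrtr1. Qed.

(** * Complex-linear maps preserving the width *)

Lemma realify_realmx (R : realType) (n : nat)
    (Psi : {linear 'cV[R[i]]_n -> 'cV[R[i]]_n}) :
  exists P : 'M[R[i]]_n, realify Psi = mulmx (realmx P).
Proof.
exists (\matrix_(i, j) Psi (delta_mx j 0) i 0); apply/funext => z.
rewrite realmxE /realify; congr of_complex.
rewrite {1}[to_complex z]matrix_sum_delta linear_sum.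
apply/colP => i; rewrite summxE !mxE; apply: eq_bigr => j _.
by rewrite big_ord1 linearZ !mxE mulrC.
Qed.

Theorem theorem5p12 (R : realType) (n : nat)
    (Psi : {linear 'cV[R[i]]_n -> 'cV[R[i]]_n}) :
  (forall M : 'M[R]_(n + n), sym_posdef M ->
     slwidth (realify Psi @` ellipsoid M) = slwidth (ellipsoid M)) <->
  (exists theta : R, forall v : 'I_n -> 'cV[R]_(n + n),
     pullback (realify Psi) (@Omega R n) v = expi theta * @Omega R n v).
Proof.
have [P ->] := realify_realmx Psi.
split=> [width_pres|[theta phase] M _].
  suff [theta detE] : exists theta, \det P = expi theta.
    by exists theta => v; rewrite /pullback Omega_realmx detE.
  apply: expi_surj; have := width_pres 1%:M (sym_posdef1 _ _).
  rewrite ellipsoid1 => wE.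
  have w0 := slwidth_ball_gt0 R n; have woo := slwidth_ball_lty R n.
  have [D0|D0] := eqVneq (\det P) 0.
    have := slwidth_ball_le P; rewrite wE D0 Normc.normc0 mul0r mule0.
    by rewrite leNgt w0.
  move: wE; rewrite slwidth_realmx ?unitmxE ?unitfE //.
  move: (slwidth _) w0 woo => [w| |] //; rewrite lte_fin => w0 _ [wE].
  by apply: (mulIf (lt0r_neq0 w0)); rewrite mul1r.
have detP : \det P = expi theta.
  have := phase (@std_frame R n).
  by rewrite /pullback Omega_realmx Omega_std_frame !mulr1.
have normP : Normc.normc (\det P) = 1 by rewrite detP normc_expi.
rewrite slwidth_realmx ?normP ?mul1e // unitmxE unitfE.
apply/eqP => D0; move: normP; rewrite D0 Normc.normc0 => /esym/eqP.
by rewrite oner_eq0.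
Qed.
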